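(* If one step of Jacobi's method is performed in floating point arithmetic in the $(p,q)$ plane on the symmetric matrix $A_k=(\hat a^{(k)}_{ij})\in\mathbb{R}^{n\times n}$ with the computed Jacobi rotation $\hat J_k=J(p,q;\hat c_k,\hat s_k)$ and the exact Jacobi rotation $J_k=J(p,q;c_k,s_k)$, then the computed $A_{k+1}$ satisfies $$A_{k+1}=J_k^TA_kJ_k+Y_k,\qquad \|Y_k\|_F\le\sqrt{(6+4\sqrt2)\|G_k\|_F^2+2\|H_k\|_F^2}\cdot\tilde\gamma_4,$$ where the symmetric matrix $G_k\in\mathbb{R}^{n\times n}$ has zero entries except that the entries at the intersections of rows and columns $p$ and $q$ are the same as those of $A_k$, and the symmetric matrix $H_k\in\mathbb{R}^{n\times n}$ has zero entries except that $(H_k)_{pj}=\hat a^{(k)}_{pj}$ and $(H_k)_{qj}=\hat a^{(k)}_{qj}$ for all $j\ne p,q$ and $(H_k)_{ip}=\hat a^{(k)}_{ip}$ and $(H_k)_{iq}=\hat a^{(k)}_{iq}$ for all $i\ne p,q$.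
   Context: $\|\cdot\|_F$ is the Frobenius norm. Floating point model with unit roundoff $u$: $\mathrm{fl}(x\,\mathrm{op}\,y)=(x\,\mathrm{op}\,y)(1+\delta_1)=(x\,\mathrm{op}\,y)/(1+\delta_2)$, $|\delta_1|,|\delta_2|\le u$, $\mathrm{op}\in\{+,-,*,/\}$; $\mathrm{fl}(\sqrt x)=\sqrt x(1+\delta)$, $|\delta|\le u$. $\tilde\gamma_j:=(1-u)^{-wj}-1$, where $w>0$ is a fixed small integer constant (not depending on the matrix, its order, or $u$) whose exact value is unimportant. Jacobi rotation: for $p<q$ and $c^2+s^2=1$ (exact rotations), $J(p,q;c,s)$ is the identity matrix except that its $(p,p)$ and $(q,q)$ entries are $c$, its $(p,q)$ entry is $s$, its $(q,p)$ entry is $-s$; the same notation is used with computed $\hat c,\hat s$. The exact Jacobi rotation for a symmetric $A$ and the pair $(p,q)$ has $c=(1+t^2)^{-1/2}$, $s=tc$, with $t=1/(\mu+\sqrt{1+\mu^2})$ if $\mu\ge0$, $t=1/(\mu-\sqrt{1+\mu^2})$ if $\mu<0$, $\mu=(a_{qq}-a_{pp})/(2a_{pq})$, and $(c,s)=(1,0)$ if $a_{pq}=0$; it makes the $(p,q)$ entry of $J^TAJ$ zero. One floating point step in the $(p,q)$ plane on the symmetric matrix $A_k=(\hat a^{(k)}_{ij})$: $J_k=J(p,q;c_k,s_k)$ denotes the exact Jacobi rotation for $A_k$ and $(p,q)$, and $\hat J_k=J(p,q;\hat c_k,\hat s_k)$ the one computed in floating point, which satisfies $\hat c_k=c_k(1+\theta)$,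 $\hat s_k=s_k(1+\theta')$ with $|\theta|,|\theta'|\le\tilde\gamma_1$. The computed symmetric matrix $A_{k+1}$ agrees with $A_k$ outside rows and columns $p,q$, and (superscript $(k)$ and subscript $k$ dropped on the right) $\hat a^{(k+1)}_{pj}=\mathrm{fl}(\hat c\hat a_{pj}-\hat s\hat a_{qj})$, $\hat a^{(k+1)}_{qj}=\mathrm{fl}(\hat s\hat a_{pj}+\hat c\hat a_{qj})$ for $j\ne p,q$, $\hat a^{(k+1)}_{pp}=\mathrm{fl}(\hat c(\hat c\hat a_{pp}-\hat s\hat a_{pq})-\hat s(\hat c\hat a_{pq}-\hat s\hat a_{qq}))$, $\hat a^{(k+1)}_{pq}=\mathrm{fl}(\hat s(\hat c\hat a_{pp}-\hat s\hat a_{pq})+\hat c(\hat c\hat a_{pq}-\hat s\hat a_{qq}))$, and $\hat a^{(k+1)}_{qq}$ is computed analogously to $\hat a^{(k+1)}_{pp}$. *)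

(* Defs.v *)
From HB Require Import structures.
From mathcomp Require Import all_boot all_order all_algebra.
Set Implicit Arguments.
Unset Strict Implicit.
Unset Printing Implicit Defensive.
Import Order.TTheory GRing.Theory Num.Theory.
Local Open Scope ring_scope.

Definition frobenius_norm (R : rcfType) (m n : nat) (A : 'M[R]_(m, n)) : R :=
  Num.sqrt (\sum_(i < m) \sum_(j < n) A i j ^+ 2).

(* The rounded operations are total functions on R: arithmetic on a set of
   floating point numbers extends to R by exact operations elsewhere. *)
Record fp_arith (R : Type) := FpArith {
  fl_add : R -> R -> R;
  fl_sub : R -> R -> R;
  fl_mul : R -> R -> R;
  fl_div : R -> R -> R;
  fl_sqrt : R -> R
}.

Definition rounds (R : rcfType) (u x xhat : R) : Prop :=
  (exists2 d1 : R, `|d1| <= u & xhat = x * (1 + d1)) /\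
  (exists2 d2 : R, `|d2| <= u & xhat = x / (1 + d2)).

Record fp_model (R : rcfType) (u : R) (F : fp_arith R) : Prop := FpModel {
  fl_addP : forall x y : R, rounds u (x + y) (fl_add F x y);
  fl_subP : forall x y : R, rounds u (x - y) (fl_sub F x y);
  fl_mulP : forall x y : R, rounds u (x * y) (fl_mul F x y);
  fl_divP : forall x y : R, y != 0 -> rounds u (x / y) (fl_div F x y);
  fl_sqrtP : forall x : R, 0 <= x ->
    exists2 d : R, `|d| <= u & fl_sqrt F x = Num.sqrt x * (1 + d)
}.

Definition gamma_tilde (R : rcfType) (w : nat) (u : R) (j : nat) : R :=
  (1 - u) ^- (w * j) - 1.

Definition rotation (R : rcfType) (n : nat) (p q : 'I_n) (c s : R) : 'M[R]_n :=
  \matrix_(i, j)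
    if (i == p) && (j == p) then c
    else if (i == q) && (j == q) then c
    else if (i == p) && (j == q) then s
    else if (i == q) && (j == p) then - s
    else (i == j)%:R.

Section ExactJacobi.
Variables (R : rcfType) (n : nat) (A : 'M[R]_n) (p q : 'I_n).

Definition jacobi_mu : R := (A q q - A p p) / (2 * A p q).

Definition jacobi_t : R :=
  if 0 <= jacobi_mu then 1 / (jacobi_mu + Num.sqrt (1 + jacobi_mu ^+ 2))
  else 1 / (jacobi_mu - Num.sqrt (1 + jacobi_mu ^+ 2)).

Definition jacobi_c : R :=
  if A p q == 0 then 1 else (Num.sqrt (1 + jacobi_t ^+ 2))^-1.

Definition jacobi_s : R :=
  if A p q == 0 then 0 else jacobi_t * jacobi_c.

Definition exact_jacobi : 'M[R]_n := rotation p q jacobi_c jacobi_s.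

Definition computed_jacobi (w : nat) (u ch sh : R) : Prop :=
  (exists2 th : R, `|th| <= gamma_tilde w u 1 & ch = jacobi_c * (1 + th)) /\
  (exists2 th' : R, `|th'| <= gamma_tilde w u 1 & sh = jacobi_s * (1 + th')).

Definition pq_block : 'M[R]_n :=
  \matrix_(i, j)
    if (i \in [:: p; q]) && (j \in [:: p; q]) then A i j else 0.

(* (+) is exclusive or: exactly one of the two indices lies in {p, q}. *)
Definition pq_border : 'M[R]_n :=
  \matrix_(i, j)
    if (i \in [:: p; q]) (+) (j \in [:: p; q]) then A i j else 0.

End ExactJacobi.

(* A' is the result of one step on A with J(p,q;c,s); every operation is
   rounded. The (q,q) entry rounds the expression
   s (s a_pp + c a_pq) + c (s a_pq + c a_qq) of (J^T A J)_qq. *)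
Record fp_jacobi_step (R : rcfType) (F : fp_arith R) (n : nat) (p q : 'I_n)
    (c s : R) (A A' : 'M[R]_n) : Prop := FpJacobiStep {
  step_sym : A'^T = A';
  step_other : forall i j : 'I_n,
    i != p -> i != q -> j != p -> j != q -> A' i j = A i j;
  step_pj : forall j : 'I_n, j != p -> j != q ->
    A' p j = fl_sub F (fl_mul F c (A p j)) (fl_mul F s (A q j));
  step_qj : forall j : 'I_n, j != p -> j != q ->
    A' q j = fl_add F (fl_mul F s (A p j)) (fl_mul F c (A q j));
  step_pp : A' p p =
    fl_sub F
      (fl_mul F c (fl_sub F (fl_mul F c (A p p)) (fl_mul F s (A p q))))
      (fl_mul F s (fl_sub F (fl_mul F c (A p q)) (fl_mul F s (A q q))));
  step_pq : A' p q =
    fl_add F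
      (fl_mul F s (fl_sub F (fl_mul F c (A p p)) (fl_mul F s (A p q))))
      (fl_mul F c (fl_sub F (fl_mul F c (A p q)) (fl_mul F s (A q q))));
  step_qq : A' q q =
    fl_add F
      (fl_mul F s (fl_add F (fl_mul F s (A p p)) (fl_mul F c (A p q))))
      (fl_mul F c (fl_add F (fl_mul F s (A p q)) (fl_mul F c (A q q))))
}.

(* Main.v *)
Require Import Defs.
From HB Require Import structures.
From mathcomp Require Import all_boot all_order all_algebra.
From mathcomp Require Import ring lra.
Set Implicit Arguments.
Unset Strict Implicit.
Unset Printing Implicit Defensive.
Import Order.TTheory GRing.Theory Num.Theory.
Local Open Scope ring_scope.

(** Write K for (1-u)^(-w), so that gamma_1 = K - 1 and gamma_4 = K^4 - 1.

    The proof is a running error analysis.  Each computed entry of A' evaluates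
    the exact expression for the entry of J^T A J, with a rounding after every
    operation and with entries of J perturbed by relative errors of at most
    K - 1.  Replacing all terms by their absolute values gives a majorant m of
    the expression, and the error is at most (D - 1) m, where D is the product
    of the factors met on a path through the expression: K for an entry of J
    and 1 + u for a rounding ([near_mul], [near_round], [near_fl_sub]).  An
    entry with exactly one index in {p, q} has D = K (1+u)^2; one with both
    indices there has D = K^2 (1+u)^4.

    The majorants are the entries of |J|^T |A| |J|.  Since |J| restricted to the
    plane has 2-norm at most sqrt 2 ([abs_rotation_sqr_le]), one application of
    it at most doubles a sum of squares, which is the coefficient 2 of the
    border H, and the two applications in the plane multiply the sum of squares
    of G by at most 4.

    For the border, D - 1 <= gamma_4 because 1 + u <= K.  For the
    block this may fail: for w = 1 and small u, D - 1 is about 6u and gamma_4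
    about 4u.  But D - 1 <= 5/3 gamma_4 always holds ([block_growth]), so the
    block contributes at most 4 (5/3)^2 = 100/9 times gamma_4^2 |G|^2, and
    100/9 is below 6 + 4 sqrt 2 = (2 + sqrt 2)^2. *)

(** * Running error analysis *)

(** The error is measured against a majorant [m] of the modulus of [x], not
    against that modulus itself, because cancellation in a sum makes its
    relative error unbounded. *)
Definition near (R : numDomainType) (D m x xh : R) : Prop :=
  `|x| <= m /\ `|xh - x| <= (D - 1) * m.

Lemma near_exact (R : numDomainType) (x : R) : near 1 `|x| x x.
Proof. by split; rewrite ?subrr ?normr0 ?mul0r. Qed.

Lemma near_rel (R : numDomainType) (k x e : R) :
  `|e| <= k -> near (1 + k) `|x| x (x * (1 + e)).
Proof.
move=> he; split=> //.
have -> : x * (1 + e) - x = e * x by ring.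
have -> : 1 + k - 1 = k by ring.
by rewrite normrM ler_wpM2r.
Qed.

(** The factors multiply because the error in [x] is multiplied by [yh], whose
    modulus is at most [D * m'], and that in [y] by [x]. *)
Lemma near_mul (R : numDomainType) (K D m m' x xh y yh : R) :
  near K m x xh -> near D m' y yh -> near (K * D) (m * m') (x * y) (xh * yh).
Proof.
move=> [xm ex] [ym ey]; split; first by rewrite normrM ler_pM.
have -> : xh * yh - x * y = (xh - x) * (yh - y + y) + x * (yh - y) by ring.
have -> : (K * D - 1) * (m * m')
  = (K - 1) * m * ((D - 1) * m' + m') + m * ((D - 1) * m') by ring.
rewrite (le_trans (ler_normD _ _)) // !normrM lerD // ler_pM //.
by rewrite (le_trans (ler_normD _ _)) // lerD.
Qed.

Lemma near_add (R : numDomainType) (D m m' x xh y yh : R) :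
  near D m x xh -> near D m' y yh -> near D (m + m') (x + y) (xh + yh).
Proof.
move=> [xm ex] [ym ey]; split.
  by rewrite (le_trans (ler_normD _ _)) // lerD.
by rewrite opprD addrACA mulrDr (le_trans (ler_normD _ _)) // lerD.
Qed.

Lemma near_opp (R : numDomainType) (D m x xh : R) :
  near D m x xh -> near D m (- x) (- xh).
Proof. by move=> [xm ex]; split; rewrite ?normrN // -opprD normrN. Qed.

(** A rounding is a multiplication by a perturbed 1. *)
Lemma near_round (R : rcfType) (u D m x xh z : R) :
  near D m x xh -> rounds u xh z -> near (D * (1 + u)) m x z.
Proof.
move=> hx [[d du ->] _].
have h1 : near (1 + u) 1 1 (1 + d).
  by have := near_rel (1 : R) du; rewrite mul1r normr1.
by have := near_mul hx h1; rewrite !mulr1.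
Qed.

(** The rounded evaluation of one row of a plane rotation, applied to operands
    that may already carry errors; nesting it twice gives the entries in the
    plane. *)
Section RoundedRotation.
Variables (R : rcfType) (u : R) (F : fp_arith R) (hF : fp_model u F).
Variables (K D c ch s sh mx x xh my y yh : R).
Hypotheses (hc : near K `|c| c ch) (hs : near K `|s| s sh).
Hypotheses (hx : near D mx x xh) (hy : near D my y yh).

Lemma near_fl_sub :
  near (K * D * (1 + u) ^+ 2) (`|c| * mx + `|s| * my) (c * x - s * y)
    (fl_sub F (fl_mul F ch xh) (fl_mul F sh yh)).
Proof.
rewrite expr2 mulrA.
have h1 := near_round (near_mul hc hx) (fl_mulP hF _ _).
have h2 := near_round (near_mul hs hy) (fl_mulP hF _ _).
exact: near_round (near_add h1 (near_opp h2)) (fl_subP hF _ _).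
Qed.

Lemma near_fl_add :
  near (K * D * (1 + u) ^+ 2) (`|c| * mx + `|s| * my) (c * x + s * y)
    (fl_add F (fl_mul F ch xh) (fl_mul F sh yh)).
Proof.
rewrite expr2 mulrA.
have h1 := near_round (near_mul hc hx) (fl_mulP hF _ _).
have h2 := near_round (near_mul hs hy) (fl_mulP hF _ _).
exact: near_round (near_add h1 h2) (fl_addP hF _ _).
Qed.

End RoundedRotation.

(** * Products of rounding factors compared with powers of 1 / (1 - u) *)

Lemma growth_ge1 (R : realFieldType) (k u : R) :
  0 < u -> u < 1 -> 1 <= k * (1 - u) -> 1 <= k.
Proof. by move=> hu0 hu1 hk; nra. Qed.

(** [1 + u <= 1 / (1 - u) <= k], so the left side is at most [k ^+ 3]. *)
Lemma border_growth (R : realFieldType) (k u : R) :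
  0 < u -> u < 1 -> 1 <= k * (1 - u) -> k * (1 + u) ^+ 2 <= k ^+ 4.
Proof.
move=> hu0 hu1 hk; have k1 := growth_ge1 hu0 hu1 hk.
have uk : 1 + u <= k by nra.
have -> : k ^+ 4 = k * k ^+ 2 * k by ring.
have h : k * (1 + u) ^+ 2 <= k * k ^+ 2.
  by rewrite ler_wpM2l ?lerXn2r ?nnegrE //; lra.
rewrite (le_trans h) // ler_peMr // mulr_ge0 ?sqr_ge0 //; lra.
Qed.

(** To first order in [u], with [k = 1 + u], the two sides are [6 u] and
    [20/3 u].  For large [k] the left side would be worse if [1 + u] were only
    bounded by [k]; the sharper [1 + u <= 2 - 1/k], that is
    [k (1 + u) <= 2 k - 1], keeps it of order [k ^+ 2]. *)
Lemma block_growth (R : realFieldType) (k u : R) :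
  0 < u -> u < 1 -> 1 <= k * (1 - u) ->
  k ^+ 2 * (1 + u) ^+ 4 - 1 <= 5 / 3 * (k ^+ 4 - 1).
Proof.
move=> hu0 hu1 hk; have k1 := growth_ge1 hu0 hu1 hk.
have k2 : 0 < k ^+ 2 by rewrite exprn_gt0 //; lra.
have h4 : (k * (1 + u)) ^+ 4 <= (2 * k - 1) ^+ 4.
  by rewrite lerXn2r ?nnegrE //; nra.
rewrite -(ler_pM2l k2).
have -> : k ^+ 2 * (k ^+ 2 * (1 + u) ^+ 4 - 1) = (k * (1 + u)) ^+ 4 - k ^+ 2.
  by ring.
apply: le_trans (lerB h4 (lexx _)) _.
have e0 : 0 <= k - 1 by lra.
(* The difference of the two sides has nonnegative coefficients in k - 1. *)
rewrite -subr_ge0.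
have -> : k ^+ 2 * (5 / 3 * (k ^+ 4 - 1)) - ((2 * k - 1) ^+ 4 - k ^+ 2)
  = (2 * (k - 1) + (k - 1) ^+ 2 + 4 * (k - 1) ^+ 3 + 27 * (k - 1) ^+ 4
     + 30 * (k - 1) ^+ 5 + 5 * (k - 1) ^+ 6) / 3 by field.
by rewrite divr_ge0 // !addr_ge0 // ?mulr_ge0 ?exprn_ge0.
Qed.

Lemma gamma_tilde_growth (R : rcfType) (w : nat) (u : R) :
  (0 < w)%N -> 0 < u -> u < 1 ->
  exists2 k : R, 1 <= k * (1 - u) &
    gamma_tilde w u 1 = k - 1 /\ gamma_tilde w u 4 = k ^+ 4 - 1.
Proof.
move=> hw hu0 hu1; exists ((1 - u) ^- w); last first.
  by rewrite /gamma_tilde muln1 exprVn exprM.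
have u1 : 0 < 1 - u by rewrite subr_gt0.
rewrite mulrC ler_pdivlMr ?exprn_gt0 // mul1r -[leRHS]expr1.
by rewrite ler_wiXn2l ?gerBl ?(ltW hu0) ?(ltW u1).
Qed.

(** * Frobenius bounds for absolute rotations *)

(** The parallelogram identity: adding the squares of [c a - s b] and
    [s a - c b] to the left side gives equality. *)
Lemma abs_rotation_sqr_le (R : realFieldType) (c s a b : R) :
  c ^+ 2 + s ^+ 2 = 1 ->
  (c * a + s * b) ^+ 2 + (s * a + c * b) ^+ 2 <= 2 * (a ^+ 2 + b ^+ 2).
Proof.
move=> cs1; rewrite -subr_ge0.
have -> : 2 * (a ^+ 2 + b ^+ 2) - ((c * a + s * b) ^+ 2 + (s * a + c * b) ^+ 2)
  = (c * a - s * b) ^+ 2 + (s * a - c * b) ^+ 2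
    + 2 * (a ^+ 2 + b ^+ 2) * (1 - (c ^+ 2 + s ^+ 2)) by ring.
by rewrite cs1 subrr mulr0 addr0 addr_ge0 ?sqr_ge0.
Qed.

(** The left side is the squared Frobenius norm of [J^T G J], for [J] and [G]
    with rows [(c, s), (s, c)] and [(a, b), (b, d)]: [abs_rotation_sqr_le]
    applies to the columns of [J^T G] and then to the rows of [(J^T G) J]. *)
Lemma abs_rotation_block_le (R : realFieldType) (c s a b d : R) :
  c ^+ 2 + s ^+ 2 = 1 ->
  (c * (c * a + s * b) + s * (c * b + s * d)) ^+ 2
  + (s * (s * a + c * b) + c * (s * b + c * d)) ^+ 2
  + 2 * (s * (c * a + s * b) + c * (c * b + s * d)) ^+ 2
  <= 4 * (a ^+ 2 + d ^+ 2 + 2 * b ^+ 2).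
Proof.
move=> cs1.
have h1 := abs_rotation_sqr_le (c * a + s * b) (c * b + s * d) cs1.
have h2 := abs_rotation_sqr_le (s * a + c * b) (s * b + c * d) cs1.
have h3 := abs_rotation_sqr_le a b cs1.
have h4 := abs_rotation_sqr_le b d cs1.
have e : s * (c * a + s * b) + c * (c * b + s * d)
  = c * (s * a + c * b) + s * (s * b + c * d) by ring.
(* [e] is the symmetry of the product; with it the left side is a sum over
   its four entries. *)
rewrite mulrDl mul1r {2}e; lra.
Qed.

(** * Sums and matrices split along the plane of rotation *)

Section Split.
Variables (n : nat) (p q : 'I_n).
Hypothesis pq : p != q.

Lemma sum_split_pq (V : nmodType) (f : 'I_n -> V) :
  \sum_i f i = f p + f q + \sum_(i | i \notin [:: p; q]) f i.
Proof.
rewrite (bigD1 p) //= (bigD1 q) 1?eq_sym //= addrA; congr (_ + _).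
by apply: eq_bigl => i; rewrite !inE negb_or.
Qed.

Lemma frobenius_norm_sqr (R : rcfType) (m k : nat) (M : 'M[R]_(m, k)) :
  frobenius_norm M ^+ 2 = \sum_i \sum_j M i j ^+ 2.
Proof.
rewrite sqr_sqrtr // sumr_ge0 // => i _.
by rewrite sumr_ge0 // => j _; rewrite sqr_ge0.
Qed.

Lemma frobenius_norm_split (R : rcfType) (M : 'M[R]_n) : M^T = M ->
  frobenius_norm M ^+ 2 =
    (M p p ^+ 2 + M q q ^+ 2 + 2 * M p q ^+ 2)
    + 2 * \sum_(j | j \notin [:: p; q]) (M p j ^+ 2 + M q j ^+ 2)
    + \sum_(i | i \notin [:: p; q]) \sum_(j | j \notin [:: p; q]) M i j ^+ 2.
Proof.
move=> sM; have sym i j : M i j = M j i by rewrite -[in LHS]sM mxE.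
rewrite frobenius_norm_sqr sum_split_pq !(sum_split_pq (fun j => M _ j ^+ 2)).
under [X in _ + X]eq_bigr => i _ do
  rewrite (sum_split_pq (fun j => M i j ^+ 2)) (sym i p) (sym i q).
rewrite !big_split /= (sym q p); ring.
Qed.

Lemma frobenius_norm_pq_block (R : rcfType) (A : 'M[R]_n) : A^T = A ->
  frobenius_norm (pq_block A p q) ^+ 2
  = A p p ^+ 2 + A q q ^+ 2 + 2 * A p q ^+ 2.
Proof.
move=> hA; have sG : (pq_block A p q)^T = pq_block A p q.
  by apply/matrixP => i j; rewrite !mxE andbC -[in LHS]hA mxE.
rewrite (frobenius_norm_split sG) !mxE !inE !eqxx !orbT /=.
rewrite !big1 ?mulr0 ?addr0 // => i hi; last first.
  by rewrite !mxE (negbTE hi) !andbF expr0n addr0.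
by rewrite big1 // => j _; rewrite mxE (negbTE hi) expr0n.
Qed.

Lemma frobenius_norm_pq_border (R : rcfType) (A : 'M[R]_n) : A^T = A ->
  frobenius_norm (pq_border A p q) ^+ 2
  = 2 * \sum_(j | j \notin [:: p; q]) (A p j ^+ 2 + A q j ^+ 2).
Proof.
move=> hA; have sH : (pq_border A p q)^T = pq_border A p q.
  by apply/matrixP => i j; rewrite !mxE addbC -[in LHS]hA mxE.
rewrite (frobenius_norm_split sH) !mxE !inE !eqxx !orbT /=.
rewrite expr0n mulr0 !add0r [X in _ + X]big1 ?addr0 => [|i hi]; last first.
  by rewrite big1 // => j hj; rewrite mxE (negbTE hi) (negbTE hj) expr0n.
congr (_ * _); apply: eq_bigr => j hj.
by rewrite !mxE (negbTE hj) !inE !eqxx orbT.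
Qed.

Lemma mulmx_rotationE (R : rcfType) m (B : 'M[R]_(m, n)) (c s : R) i j :
  (B *m rotation p q c s) i j =
    if j == p then c * B i p - s * B i q
    else if j == q then s * B i p + c * B i q else B i j.
Proof.
have qp : q == p = false by rewrite eq_sym (negbTE pq).
have pq' := negbTE pq.
rewrite mxE sum_split_pq !mxE !eqxx qp pq' /=.
have rest : \sum_(k | k \notin [:: p; q]) B i k * rotation p q c s k j
    = \sum_(k | k \notin [:: p; q]) B i k * (k == j)%:R.
  apply: eq_bigr => k; rewrite !inE negb_or => /andP[/negbTE kp /negbTE kq].
  by rewrite mxE kp kq.
rewrite {}rest.
have [jpq|jpq] := boolP (j \in [:: p; q]).
  rewrite big1 => [|k kpq]; last first.
    by case: eqP kpq => [->|_ _]; [rewrite jpq|rewrite mulr0].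
  move: jpq; rewrite !inE; have [->|jp] := eqVneq j p => /=.
    by rewrite pq' => _; ring.
  by move=> /eqP ->; rewrite eqxx; ring.
rewrite (bigD1 j) //= eqxx big1 => [|k /andP[_ /negbTE ->]]; last first.
  by rewrite mulr0.
move: jpq; rewrite !inE negb_or => /andP[/negbTE jp /negbTE jq].
by rewrite (eq_sym p) (eq_sym q) jp jq !mulr0 !add0r mulr1 addr0.
Qed.

Lemma mul_tr_rotationE (R : rcfType) m (B : 'M[R]_(n, m)) (c s : R) i j :
  ((rotation p q c s)^T *m B) i j =
    if i == p then c * B p j - s * B q j
    else if i == q then s * B p j + c * B q j else B i j.
Proof.
by rewrite -[B in LHS]trmxK -trmx_mul mxE mulmx_rotationE !mxE.
Qed.

End Split.

(** * One rounded Jacobi step *)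

Lemma jacobi_cs1 (R : rcfType) n (A : 'M[R]_n) (p q : 'I_n) :
  jacobi_c A p q ^+ 2 + jacobi_s A p q ^+ 2 = 1.
Proof.
rewrite /jacobi_s /jacobi_c; case: ifP => _.
  by rewrite expr1n expr0n addr0.
have t0 : 0 < 1 + jacobi_t A p q ^+ 2 by rewrite ltr_wpDr ?sqr_ge0.
rewrite exprMn -[X in X + _]mul1r -mulrDl exprVn sqr_sqrtr ?ltW //.
by rewrite mulfV ?gt_eqF.
Qed.

Lemma near_sqr_le (R : rcfType) (D m x xh g : R) :
  near D m x xh -> D - 1 <= g -> (xh - x) ^+ 2 <= g ^+ 2 * m ^+ 2.
Proof.
move=> [xm ex] Dg; rewrite -exprMn -real_normK ?num_real //.
have m0 : 0 <= m by apply: le_trans xm.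
have h : `|xh - x| <= g * m by apply: le_trans ex _; rewrite ler_wpM2r.
by rewrite lerXn2r ?nnegrE // (le_trans _ h).
Qed.

Theorem lemma3p5 (R : rcfType) (w : nat) (hw : (0 < w)%N)
    (u : R) (hu0 : 0 < u) (hu1 : u < 1)
    (F : fp_arith R) (hF : fp_model u F)
    (n : nat) (p q : 'I_n) (hpq : (p < q)%N)
    (A A' : 'M[R]_n) (hA : A^T = A)
    (ch sh : R) (hJ : computed_jacobi A p q w u ch sh)
    (hstep : fp_jacobi_step F p q ch sh A A') :
  let J := exact_jacobi A p q in
  let G := pq_block A p q in
  let H := pq_border A p q in
  exists Y : 'M[R]_n,
    A' = J^T *m A *m J + Y /\
    frobenius_norm Y <=
      Num.sqrt ((6 + 4 * Num.sqrt 2) * frobenius_norm G ^+ 2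
                + 2 * frobenius_norm H ^+ 2) * gamma_tilde w u 4.
Proof.
move=> J G H; pose Y := A' - J^T *m A *m J.
exists Y; split; first by rewrite /Y addrC subrK.
have pq : p != q by rewrite -(inj_eq val_inj) /= ltn_eqF.
have qp : q != p by rewrite eq_sym.
have sA i j : A i j = A j i by rewrite -[in LHS]hA mxE.
set c := jacobi_c A p q; set s := jacobi_s A p q.
have cs1 : `|c| ^+ 2 + `|s| ^+ 2 = 1.
  by rewrite !real_normK ?num_real // jacobi_cs1.
have [K K_ge [g1E g4E]] := gamma_tilde_growth hw hu0 hu1.
have [hc hs] : near K `|c| c ch /\ near K `|s| s sh.
  have KE : K = 1 + gamma_tilde w u 1 by rewrite g1E addrC subrK.
  by rewrite KE; case: hJ => [[t ht ->] [t' ht' ->]]; split; apply: near_rel.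
set g := gamma_tilde w u 4.
have YE i j : Y i j = A' i j - (J^T *m A *m J) i j by rewrite /Y !mxE.
have JE i j : (J^T *m A *m J) i j =
    if j == p then c * (J^T *m A) i p - s * (J^T *m A) i q
    else if j == q then s * (J^T *m A) i p + c * (J^T *m A) i q
    else (J^T *m A) i j by apply: mulmx_rotationE.
have JTE i j : (J^T *m A) i j =
    if i == p then c * A p j - s * A q j
    else if i == q then s * A p j + c * A q j else A i j
  by apply: mul_tr_rotationE.
have sY : Y^T = Y.
  by rewrite /Y linearB /= (step_sym hstep) !trmx_mul trmxK hA mulmxA.
have g0 : 0 <= g.
  by rewrite /g g4E subr_ge0 exprn_ege1 // (growth_ge1 hu0 hu1 K_ge).
have border j : j \notin [:: p; q] ->
    Y p j ^+ 2 + Y q j ^+ 2 <= g ^+ 2 * (2 * (A p j ^+ 2 + A q j ^+ 2)).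
  rewrite !inE negb_or => /andP[jp jq].
  have e1 := near_exact (A p j); have e2 := near_exact (A q j).
  have h1 := near_fl_sub hF hc hs e1 e2.
  have h2 := near_fl_add hF hs hc e1 e2.
  have Dg : K * 1 * (1 + u) ^+ 2 - 1 <= g.
    by rewrite mulr1 /g g4E lerD2r; apply: border_growth.
  have := lerD (near_sqr_le h1 Dg) (near_sqr_le h2 Dg).
  rewrite -(step_pj hstep jp jq) -(step_qj hstep jp jq).
  rewrite !YE !JE !JTE !eqxx (negbTE jp) (negbTE jq) (negbTE qp) => h.
  apply: le_trans h _; rewrite -mulrDr ler_wpM2l ?sqr_ge0 //.
  apply: le_trans (abs_rotation_sqr_le _ _ cs1) _.
  by rewrite !real_normK ?num_real.
have block : Y p p ^+ 2 + Y q q ^+ 2 + 2 * Y p q ^+ 2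
    <= (5 / 3 * g) ^+ 2 * (4 * (A p p ^+ 2 + A q q ^+ 2 + 2 * A p q ^+ 2)).
  have ep := near_exact (A p p); have eb := near_exact (A p q).
  have ed := near_exact (A q q).
  have r1 := near_fl_sub hF hc hs ep eb.
  have r2 := near_fl_sub hF hc hs eb ed.
  have r3 := near_fl_add hF hs hc ep eb.
  have r4 := near_fl_add hF hs hc eb ed.
  have Dg : K * (K * 1 * (1 + u) ^+ 2) * (1 + u) ^+ 2 - 1 <= 5 / 3 * g.
    rewrite /g g4E; apply: le_trans (block_growth hu0 hu1 K_ge).
    by rewrite le_eqVlt; apply/orP; left; apply/eqP; ring.
  have hpp := near_sqr_le (near_fl_sub hF hc hs r1 r2) Dg.
  have hqq := near_sqr_le (near_fl_add hF hs hc r3 r4) Dg.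
  have hpq' := near_sqr_le (near_fl_add hF hs hc r1 r2) Dg.
  rewrite -(step_pp hstep) in hpp; rewrite -(step_qq hstep) in hqq.
  rewrite -(step_pq hstep) in hpq'.
  have := abs_rotation_block_le `|A p p| `|A p q| `|A q q| cs1.
  rewrite !(real_normK (num_real (A _ _))) => hb.
  apply: le_trans (ler_wpM2l (sqr_ge0 _) hb).
  have -> : Y p p = A' p p
      - (c * (c * A p p - s * A p q) - s * (c * A p q - s * A q q)).
    by rewrite YE JE !JTE !eqxx (sA q p); ring.
  have -> : Y q q = A' q q
      - (s * (s * A p p + c * A p q) + c * (s * A p q + c * A q q)).
    by rewrite YE JE !JTE !eqxx (negbTE qp) (sA q p); ring.
  have -> : Y p q = A' p q
      - (s * (c * A p p - s * A p q) + c * (c * A p q - s * A q q)).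
    by rewrite YE JE !JTE !eqxx (negbTE qp) (sA q p); ring.
  rewrite [leRHS]mulrDr [X in _ <= X + _]mulrDr; apply: lerD; first exact: lerD.
  by rewrite [leRHS]mulrCA ler_wpM2l.
have rest i j : i \notin [:: p; q] -> j \notin [:: p; q] -> Y i j = 0.
  rewrite !inE !negb_or => /andP[ip iq] /andP[jp jq].
  rewrite YE JE !JTE (negbTE ip) (negbTE iq) (negbTE jp) (negbTE jq).
  by rewrite (step_other hstep) // subrr.
have nG := frobenius_norm_pq_block pq hA.
have nH := frobenius_norm_pq_border pq hA.
have nY : frobenius_norm Y ^+ 2 <=
    (5 / 3 * g) ^+ 2 * (4 * frobenius_norm G ^+ 2)
    + g ^+ 2 * (2 * frobenius_norm H ^+ 2).
  rewrite (frobenius_norm_split pq sY) nG nH.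
  rewrite [X in _ + X]big1 ?addr0 => [|i hi]; last first.
    by rewrite big1 // => j hj; rewrite rest // expr0n.
  apply: lerD => //; rewrite [leRHS]mulrCA ler_pM2l // mulrA mulr_sumr.
  by apply: ler_sum => j hj; rewrite -mulrA border.
have G0 : 0 <= frobenius_norm G ^+ 2 by apply: sqr_ge0.
have H0 : 0 <= frobenius_norm H ^+ 2 by apply: sqr_ge0.
(* The final comparison 100 / 9 <= 6 + 4 sqrt 2 amounts to sqrt 2 >= 23 / 18,
   which is below 13 / 10. *)
have r2 : 13 / 10 <= Num.sqrt 2 :> R.
  have s2 : Num.sqrt 2 ^+ 2 = 2 :> R by rewrite sqr_sqrtr.
  have := sqrtr_ge0 (2 : R); nra.
rewrite -[leLHS]ger0_norm ?sqrtr_ge0 // -sqrtr_sqr -[X in _ * X]ger0_norm //.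
rewrite -sqrtr_sqr -sqrtrM; last first.
  by apply: addr_ge0; apply: mulr_ge0 => //; lra.
apply: ler_wsqrtr; apply: le_trans nY _.
rewrite [leRHS]mulrC [leRHS]mulrDr lerD2r exprMn [_ * g ^+ 2]mulrC -mulrA.
rewrite ler_wpM2l ?sqr_ge0 // mulrA ler_wpM2r //; lra.
Qed.
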